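(* Let $\{\Pi_i\}$ be a set of $m$ projectors on $\mathbb{C}^d$, and define $\delta$ to be the spectral gap of the associated Hamiltonian $H=\frac1m\sum_i\Pi_i$. Consider the following iterated measurement process, starting from the maximally mixed state. In each step, a projector $\Pi_i$ is chosen independently uniformly at random, and the two-outcome measurement $\{\Pi_i,\mathbb{1}-\Pi_i\}$ is performed. This is repeated until a $\Pi_i$ outcome is obtained, at which point the process halts. Let $\rho_a$ denote the final state of the system given that it halted on outcome $\Pi_a$, and $p_a$ the probability that this occurs. Then the (unnormalised) density matrix corresponding to the process halting on outcome $\Pi_a$ satisfies $$X_a=p_a\rho_a\le\frac{1}{m\delta}\,\frac{\Pi_a}{d},$$ hence $$p_a=\operatorname{tr}(X_a)\le\frac{1}{m\delta}\,\frac{\operatorname{tr}(\Pi_a)}{d}.$$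
   Context: Projectors are orthogonal projectors, not assumed to commute. The maximally mixed state is $\mathbb{1}/d$. The spectral gap of $H$ is the difference between its smallest and second-smallest eigenvalues (ignoring degeneracies). $X\le Y$ means that $Y-X$ is positive semidefinite.
   Formalization: Added assumption: the smallest eigenvalue of H is 0 or at least δ. Without it the claim fails, e.g. diagonal projectors on {0,1},{0,2},{1,2},{0,1,2},{3} in C^4: δ=2/5, p_5=1/4, but the bound is 1/8. *)

(* Defs.v *)
From HB Require Import structures.
From mathcomp Require Import all_boot all_order all_algebra.
From mathcomp Require Import complex.
From mathcomp Require Import all_classical all_reals all_analysis.

Set Implicit Arguments.
Unset Strict Implicit.
Unset Printing Implicit Defensive.

Import Order.TTheory GRing.Theory Num.Theory.
Import numFieldNormedType.Exports.

Local Open Scope classical_set_scope.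
Local Open Scope ring_scope.
Local Open Scope complex_scope.
Local Open Scope sesquilinear_scope.

Section LinearAlgebra.
Variables (R : realType) (d : nat).
Implicit Types A B : 'M[R[i]]_d.

Definition projector A : Prop := A \is hermsymmx /\ A *m A = A.

(* [0 <= z] in [R[i]] means that z is a nonnegative real, so a matrix that is
   positive semidefinite in this sense is Hermitian. *)
Definition psd A : Prop := forall v : 'cV[R[i]]_d, 0 <= (v^t* *m A *m v) 0 0.

Definition loewner_le A B : Prop := psd (B - A).

Definition smallest_eigenvalue A (l : R[i]) : Prop :=
  eigenvalue A l /\ forall mu, eigenvalue A mu -> l <= mu.

(* Eigenvalues are counted without multiplicity: [A] has a spectral gap only if
   it has at least two distinct eigenvalues. *)
Definition spectral_gap A (delta : R[i]) : Prop :=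
  exists l1 l2 : R[i],
    [/\ smallest_eigenvalue A l1,
        eigenvalue A l2 /\ l1 < l2,
        forall mu, eigenvalue A mu -> mu = l1 \/ l2 <= mu
      & delta = l2 - l1].

Definition maximally_mixed : 'M[R[i]]_d := (d%:R)^-1 *: 1%:M.

Definition born_prob (Q rho : 'M[R[i]]_d) : R[i] := \tr (Q *m rho).

(* For an outcome of probability zero this is the zero matrix. *)
Definition post_measurement (Q rho : 'M[R[i]]_d) : 'M[R[i]]_d :=
  (born_prob Q rho)^-1 *: (Q *m rho *m Q).

End LinearAlgebra.

Section Process.
Variables (R : realType) (d m : nat) (Pi : 'I_m -> 'M[R[i]]_d).

Definition hamiltonian : 'M[R[i]]_d := (m%:R)^-1 *: \sum_(i < m) Pi i.

(* A branch of the process: the probability of reaching it and the normalised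
   state of the system there. *)
Definition branch := (R[i] * 'M[R[i]]_d)%type.

(* A projector is drawn uniformly from the m possible ones, and it is the one
   whose measurement gave the outcome [Q]. *)
Definition measure_step (Q : 'M[R[i]]_d) (b : branch) : branch :=
  (b.1 * (m%:R^-1 * born_prob Q b.2), post_measurement Q b.2).

(* The projectors drawn so far are listed by [h], earliest first, and none of
   the measurements gave its [Pi i] outcome. *)
Definition running_branch (h : seq 'I_m) : branch :=
  foldl (fun b i => measure_step (1%:M - Pi i) b) (1, maximally_mixed R d) h.

Definition halted_branch (a : 'I_m) (h : seq 'I_m) : branch :=
  measure_step (Pi a) (running_branch h).

(* [halt_prob_at a t] is the probability of halting on [Pi a] after exactly t
   unsuccessful steps. *)
Definition halt_prob_at (a : 'I_m) (t : nat) : R[i]^o :=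
  \sum_(h : t.-tuple 'I_m) (halted_branch a h).1.

Definition halt_state_at (a : 'I_m) (t : nat) : 'M[R[i]^o]_d :=
  \sum_(h : t.-tuple 'I_m) (halted_branch a h).1 *: (halted_branch a h).2.

Definition halt_prob (a : 'I_m) : R[i] := limn (series (halt_prob_at a)).

Definition halt_state (a : 'I_m) : 'M[R[i]]_d :=
  (halt_prob a)^-1 *: limn (series (halt_state_at a)).

End Process.

(* Main.v *)
Require Import Defs.
From mathcomp Require Import all_boot all_order all_algebra.
From mathcomp Require Import complex ring.
From mathcomp Require Import all_classical all_reals all_analysis.

Import Order.TTheory GRing.Theory Num.Theory.
Import numFieldNormedType.Exports.

Local Open Scope classical_set_scope.
Local Open Scope ring_scope.
Local Open Scope complex_scope.
Local Open Scope sesquilinear_scope.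

(* Write H for the Hamiltonian, E for the unnormalised map of one failed round
   and P for the projection onto the range of H.  In both ground-energy cases
   every eigenvalue of H is 0 or at least delta, so delta P <= H.  Each Pi_i
   absorbs P, whence E(P) = P - H <= P - delta P and, telescoping,
   delta * sum_(t < T) E^t(P) <= P - E^T(P) <= P.  As E fixes 1 - P, which each
   Pi_a annihilates, Pi_a E^t(1) Pi_a = Pi_a E^t(P) Pi_a, so conjugating by Pi_a
   bounds the sum over all halting times by Pi_a / delta.  The partial sums
   increase in the Loewner order; by polarization they converge entrywise. *)

(** * Conjugate transposes *)

Section Adjoint.
Context {C : numClosedFieldType}.

Lemma adjmxM m n p (A : 'M[C]_(m, n)) (B : 'M[C]_(n, p)) :
  (A *m B)^t* = B^t* *m A^t*.
Proof. by rewrite trmx_mul map_mxM. Qed.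

Lemma adjmxK m n (A : 'M[C]_(m, n)) : A^t*^t* = A.
Proof. by apply/matrixP => i j; rewrite !mxE conjCK. Qed.

Lemma adjmxB m n (A B : 'M[C]_(m, n)) : (A - B)^t* = A^t* - B^t*.
Proof. by rewrite linearB map_mxB. Qed.

Lemma adjmx1 n : (1%:M : 'M[C]_n)^t* = 1%:M.
Proof. by rewrite trmx1 map_mx1. Qed.

Lemma hermitian_adjmx n (A : 'M[C]_n) : A \is hermsymmx -> A^t* = A.
Proof. by move=> /is_hermitianmxP; rewrite expr0 scale1r => <-. Qed.

(** The trace is the squared Frobenius norm, a sum of nonnegative terms, one for each entry. *)
Lemma mxtrace_adj_mul_eq0 m n (A : 'M[C]_(m, n)) :
  \tr (A^t* *m A) = 0 -> A = 0.
Proof.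
have sum_ge0 j : 0 <= \sum_i `|A i j| ^+ 2.
  by apply: sumr_ge0 => i _; rewrite exprn_ge0.
have -> : \tr (A^t* *m A) = \sum_j \sum_i `|A i j| ^+ 2.
  apply: eq_bigr => j _; rewrite mxE; apply: eq_bigr => i _.
  by rewrite !mxE normCK mulrC.
move=> /eqP; rewrite psumr_eq0 // => /allP trA0.
apply/matrixP => i j; rewrite mxE.
move: (trA0 j (mem_index_enum _)) => /=.
rewrite psumr_eq0 => [|k _]; last by rewrite exprn_ge0.
by move=> /allP /(_ i (mem_index_enum _)) /=; rewrite sqrf_eq0 normr_eq0 => /eqP.
Qed.

End Adjoint.

(** * Quadratic forms and polarization *)

Section QuadraticForm.
Context {C : numClosedFieldType} {d : nat}.
Implicit Types A B : 'M[C]_d.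

Definition qform A (v : 'cV[C]_d) : C := (v^t* *m A *m v) 0 0.

Lemma qformD A B v : qform (A + B) v = qform A v + qform B v.
Proof. by rewrite /qform mulmxDr mulmxDl mxE. Qed.

Lemma qformB A B v : qform (A - B) v = qform A v - qform B v.
Proof. by rewrite /qform mulmxBr mulmxBl !mxE. Qed.

Lemma qformZ c A v : qform (c *: A) v = c * qform A v.
Proof. by rewrite /qform -scalemxAr -scalemxAl mxE. Qed.

Lemma qformE A v : qform A v = \sum_j \sum_i (v i 0)^* * A i j * v j 0.
Proof.
rewrite /qform mxE; apply: eq_bigr => j _; rewrite mxE mulr_suml.
by apply: eq_bigr => i _; rewrite !mxE.
Qed.

Lemma qform_delta A i : qform A (delta_mx i 0) = A i i.
Proof.
rewrite qformE (bigD1 i) //= (bigD1 i) //= !mxE !eqxx /=.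
rewrite big1 => [|k ki]; last by rewrite !mxE (negbTE ki) conjC0 !mul0r.
rewrite big1 => [|k ki]; last first.
  by rewrite big1 // => l _; rewrite !mxE (negbTE ki) mulr0.
by rewrite conjC1 mul1r mulr1 !addr0.
Qed.

Lemma mulmx_delta_adj A i j :
  ((delta_mx i 0 : 'cV[C]_d)^t* *m A *m (delta_mx j 0 : 'cV[C]_d)) 0 0 = A i j.
Proof.
rewrite trmx_delta.
have -> : map_mx Num.conj (delta_mx 0 i : 'rV[C]_d) = delta_mx 0 i.
  by apply/matrixP => k l; rewrite !mxE conjC_nat.
by rewrite -rowE -colE !mxE.
Qed.

Lemma qform_delta_add A i j z :
  qform A (delta_mx i 0 + z *: delta_mx j 0)
  = A i i + z * A i j + z^* * A j i + (z^* * z) * A j j.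
Proof.
have adjE : (delta_mx i 0 + z *: delta_mx j 0 : 'cV[C]_d)^t*
    = (delta_mx i 0)^t* + z^* *: (delta_mx j 0)^t*.
  by apply/matrixP => k l; rewrite !mxE rmorphD rmorphM.
rewrite /qform adjE !mulmxDl !mulmxDr -!scalemxAl -!scalemxAr.
have addE (X Y : 'M[C]_1) : (X + Y) 0 0 = X 0 0 + Y 0 0 by rewrite mxE.
have scaleE c (X : 'M[C]_1) : (c *: X) 0 0 = c * X 0 0 by rewrite mxE.
by rewrite !(addE, scaleE) !mulmx_delta_adj; ring.
Qed.

(* Polarization identity. *)
Lemma entry_qform A i j :
  A i j = 2^-1 * ((qform A (delta_mx i 0 + 1 *: delta_mx j 0)
                   - qform A (delta_mx i 0) - qform A (delta_mx j 0))
                  - 'i%R * (qform A (delta_mx i 0 + 'i%R *: delta_mx j 0)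
                   - qform A (delta_mx i 0) - qform A (delta_mx j 0))).
Proof.
rewrite !qform_delta_add !qform_delta conjC1 conjCi.
apply: (@mulfI _ (2 : C)); first by rewrite pnatr_eq0.
rewrite mulrA mulfV ?pnatr_eq0 // mul1r.
have ii : 'i%R * 'i%R = -1 :> C by rewrite -expr2 sqrCi.
move: (A i j) (A j i) (A i i) (A j j) => a b x y.
(* [ring] treats the imaginary unit as an indeterminate. The middle term is the polynomial expansion
   of the right-hand side, so [ii] is used only in the first equality. *)
transitivity (a + b - 'i%R * 'i%R * (a - b) + 'i%R * ('i%R * 'i%R + 1) * y).
  by rewrite ii; ring.
by ring.
Qed.

(** The diagonal entries are nonnegative with sum zero, hence vanish. The form at e_i + z e_j is
    then odd in z, so being nonnegative at z and at -z makes it zero, and polarization gives every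
    entry. *)
Lemma qform_ge0_tr_eq0 A : (forall v, 0 <= qform A v) -> \tr A = 0 -> A = 0.
Proof.
move=> pA /eqP; rewrite psumr_eq0 => [|i _]; last by rewrite -qform_delta.
move=> /allP trA0.
have A0 i : A i i = 0 by have /= /eqP := trA0 i (mem_index_enum _).
have q0 i j z : qform A (delta_mx i 0 + z *: delta_mx j 0) = 0.
  apply/eqP; rewrite eq_le; apply/andP; split; last exact: pA.
  rewrite -oppr_ge0.
  have -> : - qform A (delta_mx i 0 + z *: delta_mx j 0)
           = qform A (delta_mx i 0 + (- z) *: delta_mx j 0).
    by rewrite !qform_delta_add !A0 rmorphN; ring.
  exact: pA.
apply/matrixP => i j; rewrite entry_qform !q0 !qform_delta !A0 mxE.
by rewrite !(subrr, mulr0).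
Qed.

End QuadraticForm.

(** * Positive semidefinite matrices and projectors *)

Section Psd.
Context {R : realType} {d : nat}.
Local Notation C := R[i].
Implicit Types A B : 'M[C]_d.

Lemma psd0 : psd (0 : 'M[C]_d).
Proof. by move=> v; rewrite mulmx0 mul0mx mxE. Qed.

Lemma psdD A B : psd A -> psd B -> psd (A + B).
Proof. by move=> pA pB v; rewrite -/(qform _ v) qformD addr_ge0 ?pA ?pB. Qed.

Lemma psdZ c A : 0 <= c -> psd A -> psd (c *: A).
Proof. by move=> c0 pA v; rewrite -/(qform _ v) qformZ mulr_ge0 ?pA. Qed.

Lemma psd_sum I (r : seq I) (P : pred I) (F : I -> 'M[C]_d) :
  (forall i, P i -> psd (F i)) -> psd (\sum_(i <- r | P i) F i).
Proof. exact: (big_ind _ psd0 psdD). Qed.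

Lemma psd_conj A B : psd A -> psd (B *m A *m B^t*).
Proof. by move=> pA v; have := pA (B^t* *m v); rewrite adjmxM adjmxK !mulmxA. Qed.

Lemma psd1 : psd (1%:M : 'M[C]_d).
Proof.
move=> v; rewrite mulmx1 mxE sumr_ge0 // => i _.
by rewrite !mxE mulrC mul_conjC_ge0.
Qed.

Lemma psd_diag (D : 'rV[C]_d) : (forall i, 0 <= D 0 i) -> psd (diag_mx D).
Proof.
move=> D0 v; rewrite -mulmxA mul_diag_mx mxE sumr_ge0 // => i _.
by rewrite !mxE mulrCA mulr_ge0 // mulrC mul_conjC_ge0.
Qed.

Lemma psd_tr A : psd A -> 0 <= \tr A.
Proof. by move=> pA; apply: sumr_ge0 => i _; rewrite -qform_delta; exact: pA. Qed.

Lemma psd_tr_eq0 A : psd A -> \tr A = 0 -> A = 0.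
Proof. exact: qform_ge0_tr_eq0. Qed.

Lemma projector_adj A : projector A -> A^t* = A.
Proof. by case=> /hermitian_adjmx. Qed.

Lemma projector_compl A : projector A -> projector (1%:M - A).
Proof.
move=> pA; have [_ AA] := pA; split.
  by apply/is_hermitianmxP; rewrite expr0 scale1r adjmxB adjmx1 projector_adj.
by rewrite mulmxBr mulmx1 mulmxBl mul1mx AA subrr subr0.
Qed.

Lemma psd_projector A : projector A -> psd A.
Proof.
move=> pA; have [_ AA] := pA.
have -> : A = A *m 1%:M *m A^t* by rewrite mulmx1 projector_adj // AA.
exact: (psd_conj _ _ psd1).
Qed.

Lemma psd_projector_conj A Q : projector Q -> psd A -> psd (Q *m A *m Q).
Proof. by move=> pQ /(psd_conj _ Q); rewrite projector_adj. Qed.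

End Psd.

(** * Spectral decomposition of Hermitian matrices *)

Section Spectral.
Context {C : numClosedFieldType} {d : nat}.
Implicit Types H : 'M[C]_d.

Lemma spectral_decomposition H : H \is hermsymmx ->
  H = (spectralmx H)^t* *m diag_mx (spectral_diag H) *m spectralmx H.
Proof.
move=> /hermitian_normalmx /orthomx_spectralP {1}->.
by rewrite invmx_unitary ?spectral_unitarymx.
Qed.

Lemma eigenvalue_spectral_diag H i : H \is hermsymmx ->
  eigenvalue H (spectral_diag H 0 i).
Proof.
move=> Hh; have Uu := spectral_unitarymx H; set U := spectralmx H in Uu *.
have UU : U *m U^t* = 1%:M by apply/unitarymxP.
have UH : U *m H = diag_mx (spectral_diag H) *m U.
  by rewrite {1}(spectral_decomposition _ Hh) !mulmxA UU mul1mx.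
(* [eigenvalue] refers to row vectors, so the eigenvector is a row of [U]; it is nonzero because [U]
   is unitary. *)
apply/eigenvalueP; exists (row i U).
  by rewrite -row_mul UH row_mul row_diag_mx -scalemxAl -rowE.
apply/eqP => Ui0; have /rowP/(_ i) := congr1 (fun v => v *m U^t*) Ui0.
by rewrite -row_mul UU mul0mx !mxE eqxx => /eqP; rewrite oner_eq0.
Qed.

End Spectral.

(** * The projection onto the range of a Hermitian matrix *)

Section Support.
Context {R : realType} {d : nat}.
Local Notation C := R[i].

Lemma support_projection (H : 'M[C]_d) (delta : C) :
  H \is hermsymmx -> 0 < delta ->
  (forall mu, eigenvalue H mu -> mu = 0 \/ delta <= mu) ->
  exists P : 'M[C]_d,
    [/\ psd P, P^t* = P, H *m P = H & psd (H - delta *: P)].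
Proof.
move=> Hh delta0 Hev; have Uu := spectral_unitarymx H.
have HE := spectral_decomposition _ Hh.
have Dev i := eigenvalue_spectral_diag H i Hh.
move: Uu HE Dev; move: (spectralmx H) (spectral_diag H) => U D Uu HE Dev.
have UU : U *m U^t* = 1%:M by apply/unitarymxP.
(* [D1] marks the nonzero eigenvalues. In the eigenbasis H - delta P then has entries 0 or mu -
   delta, where mu is a nonzero eigenvalue and so at least delta. *)
pose D1 : 'rV[C]_d := \row_i (D 0 i != 0)%:R.
have conj_psd (K : 'rV[C]_d) : (forall i, 0 <= K 0 i) ->
    psd (U^t* *m diag_mx K *m U).
  by move=> K0; have := psd_conj _ (U^t*) (psd_diag _ K0); rewrite adjmxK.
exists (U^t* *m diag_mx D1 *m U); split.
- by apply: conj_psd => i; rewrite mxE ler0n.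
- rewrite !adjmxM adjmxK mulmxA; congr (_ *m _ *m _).
  rewrite tr_diag_mx map_diag_mx; congr diag_mx.
  by apply/rowP => i; rewrite !mxE rmorph_nat.
- rewrite HE -!mulmxA (mulmxA U) UU mul1mx (mulmxA (diag_mx D)) mulmx_diag.
  congr (_ *m (diag_mx _ *m _)); apply/rowP => i; rewrite !mxE.
  by case: eqVneq => [->|_]; rewrite ?mul0r ?mulr1.
- rewrite HE scalemxAl scalemxAr -mulmxBl -mulmxBr.
  rewrite -[delta *: _]linearZ -linearB; apply: conj_psd => i; rewrite !mxE.
  have [D0|D0] := eqVneq (D 0 i) 0; first by rewrite D0 mulr0 subr0.
  rewrite mulr1 subr_ge0; case: (Hev _ (Dev i)) => // D0'.
  by rewrite D0' eqxx in D0.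
Qed.

End Support.

(** * Sums over histories and a telescoping identity *)

Lemma big_tuple_cons (V : nmodType) (I : finType) n (F : seq I -> V) :
  \sum_(h : n.+1.-tuple I) F h = \sum_i \sum_(h : n.-tuple I) F (i :: h).
Proof.
rewrite pair_big /=.
rewrite (reindex (fun p : I * n.-tuple I => [tuple of p.1 :: p.2])) //=.
exists (fun h : n.+1.-tuple I => (thead h, [tuple of behead h])).
  by case=> i h _ /=; congr pair; apply/val_inj.
by move=> h _; rewrite [RHS]tuple_eta; apply/val_inj.
Qed.

(** With x t = E^t(P), every summand on the right and the remainder [x n] will be positive
    semidefinite. *)
Lemma sub_scale_sum (K : pzRingType) (V : lmodType K) (x : nat -> V) (c : K) n :
  x 0%N - c *: \sum_(0 <= t < n) x t
  = \sum_(0 <= t < n) (x t - x t.+1 - c *: x t) + x n.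
Proof.
elim: n => [|n IH]; first by rewrite !big_geq // scaler0 subr0 add0r.
rewrite !big_nat_recr //= scalerDr opprD addrA IH.
by rewrite [x n - _ - _]addrAC -[RHS]addrA subrK addrA.
Qed.

(** * The process as iteration of a linear map on unnormalised states *)

Section Process.
Context {R : realType} {d m : nat} (Pi : 'I_m -> 'M[R[i]]_d).
Hypothesis Pi_proj : forall i, projector (Pi i).
Local Notation C := R[i].
Implicit Types X Y : 'M[C]_d.

(** Unlike the normalised state, this product evolves linearly, so branches can be summed before the
    next measurement. *)
Definition unnormalised (b : branch R d) : 'M[C]_d := b.1 *: b.2.

(** The map E: the average over the drawn projector, without renormalisation. *)
Definition failed_round (X : 'M[C]_d) : 'M[C]_d :=
  m%:R^-1 *: \sum_i ((1%:M - Pi i) *m X *m (1%:M - Pi i)).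

Lemma tr_projector_conj (Q rho : 'M[C]_d) : projector Q ->
  \tr (Q *m rho *m Q) = born_prob Q rho.
Proof. by case=> _ QQ; rewrite /born_prob mxtrace_mulC mulmxA QQ. Qed.

(** The Born probability cancels the normalisation. When it is zero, the conjugated state is
    positive semidefinite of trace zero, hence zero, and both sides vanish. *)
Lemma unnormalised_measure_step (Q : 'M[C]_d) (b : branch R d) :
  projector Q -> psd b.2 ->
  unnormalised (measure_step m Q b) = m%:R^-1 *: (Q *m unnormalised b *m Q).
Proof.
move=> Qp pb; rewrite /unnormalised /measure_step /post_measurement /=.
rewrite -scalemxAr -scalemxAl !scalerA.
have [q0|q0] := eqVneq (born_prob Q b.2) 0; last first.
  by rewrite mulrA mulfK // mulrC.
have -> : Q *m b.2 *m Q = 0; last by rewrite !scaler0.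
by apply: psd_tr_eq0; [exact: psd_projector_conj | rewrite tr_projector_conj].
Qed.

Lemma measure_step_prob (Q : 'M[C]_d) (b : branch R d) :
  projector Q -> psd b.2 ->
  (measure_step m Q b).1 = \tr (unnormalised (measure_step m Q b)).
Proof.
move=> Qp pb; rewrite unnormalised_measure_step // mxtraceZ tr_projector_conj //.
by rewrite /born_prob -scalemxAr mxtraceZ /= mulrCA.
Qed.

Lemma psd_measure_step (Q : 'M[C]_d) (b : branch R d) :
  projector Q -> psd b.2 -> psd (measure_step m Q b).2.
Proof.
move=> Qp pb; have QbQ := psd_projector_conj _ _ Qp pb; apply: psdZ => //.
by rewrite invr_ge0 -tr_projector_conj // psd_tr.
Qed.

Definition failed_step (b : branch R d) i := measure_step m (1%:M - Pi i) b.

Lemma psd_maximally_mixed : psd (maximally_mixed R d).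
Proof. by apply: psdZ; [rewrite invr_ge0 ler0n | exact: psd1]. Qed.

Lemma psd_failed_steps (h : seq 'I_m) b :
  psd b.2 -> psd (foldl failed_step b h).2.
Proof.
elim: h b => [|i h IH] b pb; first exact: pb.
exact: IH (psd_measure_step _ _ (projector_compl _ (Pi_proj i)) pb).
Qed.

Lemma psd_running_branch (h : seq 'I_m) : psd (running_branch Pi h).2.
Proof. exact: (psd_failed_steps h (1, _) psd_maximally_mixed). Qed.

Lemma failed_round_sum (I : finType) (F : I -> 'M[C]_d) :
  failed_round (\sum_k F k) = \sum_k failed_round (F k).
Proof.
rewrite /failed_round -scaler_sumr exchange_big /=; congr (_ *: _).
by apply: eq_bigr => i _; rewrite -mulmx_suml -mulmx_sumr.
Qed.

(** Induction on the first draw, with [b] general because that draw changes the starting branch of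
    the remaining history. *)
Lemma sum_unnormalised_failed_steps t b : psd b.2 ->
  \sum_(h : t.-tuple 'I_m) unnormalised (foldl failed_step b h)
  = iter t failed_round (unnormalised b).
Proof.
elim: t b => [|t IH] b pb.
  rewrite (big_pred1 [tuple]) //= => h; rewrite tuple0; apply/esym/eqP.
  exact: tuple0.
rewrite (big_tuple_cons _ _ t (fun h => unnormalised (foldl failed_step b h))) /=.
have step_proj i := projector_compl _ (Pi_proj i).
transitivity (\sum_i iter t failed_round (unnormalised (failed_step b i))).
  by apply: eq_bigr => i _; rewrite IH //; apply: psd_measure_step.
(* A second induction moves the sum over the first draw through the iterates of E by additivity. *)
rewrite -iterS iterSr; elim: t {IH} => [|t IH] /=.
  rewrite /failed_round scaler_sumr; apply: eq_bigr => i _.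
  exact: unnormalised_measure_step.
by rewrite -failed_round_sum IH.
Qed.

Lemma sum_unnormalised_running t :
  \sum_(h : t.-tuple 'I_m) unnormalised (running_branch Pi h)
  = iter t failed_round (maximally_mixed R d).
Proof.
rewrite (sum_unnormalised_failed_steps t (1, _) psd_maximally_mixed).
by rewrite /unnormalised scale1r.
Qed.

Lemma halt_state_atE a t :
  halt_state_at Pi a t
  = m%:R^-1 *: (Pi a *m iter t failed_round (maximally_mixed R d) *m Pi a).
Proof.
rewrite -sum_unnormalised_running mulmx_sumr mulmx_suml scaler_sumr.
apply: eq_bigr => h _.
exact: unnormalised_measure_step (Pi_proj a) (psd_running_branch h).
Qed.

Lemma halt_prob_atE a t : halt_prob_at Pi a t = \tr (halt_state_at Pi a t).
Proof.
rewrite /halt_prob_at /halt_state_at [RHS]raddf_sum; apply: eq_bigr => h _.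
exact: measure_step_prob (Pi_proj a) (psd_running_branch h).
Qed.

Lemma psd_failed_round X : psd X -> psd (failed_round X).
Proof.
move=> pX; apply: psdZ; first by rewrite invr_ge0 ler0n.
apply: psd_sum => i _.
by apply: psd_projector_conj => //; exact: projector_compl.
Qed.

Lemma failed_roundB X Y :
  failed_round (X - Y) = failed_round X - failed_round Y.
Proof.
rewrite /failed_round -scalerBr -sumrB.
rewrite (eq_bigr (fun i => (1%:M - Pi i) *m X *m (1%:M - Pi i)
  - (1%:M - Pi i) *m Y *m (1%:M - Pi i))) // => i _.
by rewrite -mulmxBl -mulmxBr.
Qed.

Lemma failed_roundZ c X : failed_round (c *: X) = c *: failed_round X.
Proof.
rewrite /failed_round.
rewrite (eq_bigr (fun i => c *: ((1%:M - Pi i) *m X *m (1%:M - Pi i)))) => [|i _].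
  by rewrite -scaler_sumr !scalerA mulrC.
by rewrite -scalemxAr -scalemxAl.
Qed.

Lemma hermitian_hamiltonian : hamiltonian Pi \is hermsymmx.
Proof.
apply/is_hermitianmxP; rewrite expr0 scale1r; apply/matrixP => i j.
rewrite !mxE !summxE rmorphM /= fmorphV rmorph_nat rmorph_sum; congr (_ * _).
by apply: eq_bigr => k _; rewrite -[in LHS](projector_adj _ (Pi_proj k)) !mxE.
Qed.

(** * Absorption of the support and the telescoped bound *)

Section Support.
Context {P : 'M[C]_d}.
Hypothesis P_adj : P^t* = P.
Hypothesis HP : hamiltonian Pi *m P = hamiltonian Pi.

(** With Q = 1 - P, H Q = 0, so the nonnegative traces of Q Pi_k Q sum to zero and each vanishes.
    For k = i this trace is the squared Frobenius norm of Pi_i Q. *)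
Lemma projector_mul_support i : Pi i *m P = Pi i.
Proof.
have m0 : m%:R != 0 :> C by rewrite pnatr_eq0; case: (m) i => [[]|].
set Q := 1%:M - P.
have Qadj : Q^t* = Q by rewrite adjmxB adjmx1 P_adj.
have pQ k : psd (Q *m Pi k *m Q).
  by have := psd_conj _ Q (psd_projector _ (Pi_proj k)); rewrite Qadj.
have sum0 : \sum_k \tr (Q *m Pi k *m Q) = 0.
  transitivity (\tr (Q *m (\sum_k Pi k) *m Q)).
    by rewrite mulmx_sumr mulmx_suml raddf_sum.
  have -> : \sum_k Pi k = m%:R *: hamiltonian Pi by rewrite scalerA mulfV // scale1r.
  rewrite -scalemxAr -scalemxAl -mulmxA [hamiltonian Pi *m Q]mulmxBr mulmx1 HP subrr.
  by rewrite mulmx0 scaler0 linear0.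
have tr0 : \tr (Q *m Pi i *m Q) = 0.
  move/eqP: sum0; rewrite psumr_eq0 => [/allP trQ0|k _]; last exact: psd_tr.
  exact/eqP/(trQ0 i (mem_index_enum _)).
have : Pi i *m Q = 0.
  apply: mxtrace_adj_mul_eq0; have [_ PP] := Pi_proj i.
  by rewrite adjmxM Qadj (projector_adj _ (Pi_proj i)) mulmxA -(mulmxA Q (Pi i)) PP.
by rewrite mulmxBr mulmx1 => /eqP; rewrite subr_eq0 => /eqP.
Qed.

Lemma support_mul_projector i : P *m Pi i = Pi i.
Proof.
have := congr1 (fun A : 'M[C]_d => A^t*) (projector_mul_support i).
by rewrite adjmxM P_adj projector_adj.
Qed.

(** By absorption on both sides, each term of the average is P - Pi_i. *)
Lemma failed_round_support : (0 < m)%N -> failed_round P = P - hamiltonian Pi.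
Proof.
move=> m0; have mC : m%:R != 0 :> C by rewrite pnatr_eq0 -lt0n.
have step i : (1%:M - Pi i) *m P *m (1%:M - Pi i) = P - Pi i.
  rewrite mulmxBl mul1mx projector_mul_support mulmxBr mulmx1 mulmxBl.
  by have [_ ->] := Pi_proj i; rewrite support_mul_projector subrr subr0.
rewrite /failed_round (eq_bigr _ (fun i _ => step i)) sumrB sumr_const card_ord.
by rewrite scalerBr -[P *+ m]scaler_nat scalerA mulVf // scale1r.
Qed.

(* The complement of the support is fixed by every failed round and is
   annihilated by every projector. *)
Lemma projector_conj_iter_failed_round a t :
  Pi a *m iter t failed_round 1%:M *m Pi a
  = Pi a *m iter t failed_round P *m Pi a.
Proof.
have fixedQ : failed_round (1%:M - P) = 1%:M - P.
  have m0 : m%:R != 0 :> C by rewrite pnatr_eq0; case: (m) a => [[]|].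
  have step i : (1%:M - Pi i) *m (1%:M - P) *m (1%:M - Pi i) = 1%:M - P.
    have -> : (1%:M - Pi i) *m (1%:M - P) = 1%:M - P.
      by rewrite mulmxBl mul1mx [Pi i *m _]mulmxBr mulmx1 projector_mul_support
                 subrr subr0.
    by rewrite mulmxBr mulmx1 [_ *m Pi i]mulmxBl mul1mx support_mul_projector
               subrr subr0.
  rewrite /failed_round (eq_bigr _ (fun i _ => step i)) sumr_const card_ord.
  by rewrite -[(1%:M - P) *+ m]scaler_nat scalerA mulVf // scale1r.
have -> : iter t failed_round 1%:M = iter t failed_round P + (1%:M - P).
  elim: t => [|t IH]; first by rewrite /= addrCA subrr addr0.
  rewrite !iterS IH -[X in _ + X]opprK failed_roundB.
  by rewrite -[in X in _ - X]scaleN1r failed_roundZ scaleN1r fixedQ !opprK.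
by rewrite mulmxDr mulmxDl mulmxBr mulmx1 projector_mul_support subrr mul0mx addr0.
Qed.

Lemma psd_iter_failed_round t X : psd X -> psd (iter t failed_round X).
Proof. by move=> pX; elim: t => [|t IH]; [exact: pX | exact: psd_failed_round]. Qed.

(* Since [failed_round P = P - H <= P - delta P], the sum telescopes. *)
Lemma sum_iter_failed_round_le (delta : C) n : (0 < m)%N -> psd P ->
  psd (hamiltonian Pi - delta *: P) ->
  psd (P - delta *: \sum_(0 <= t < n) iter t failed_round P).
Proof.
move=> m0 pP gapP.
have step t : psd (iter t failed_round P - iter t.+1 failed_round P
                   - delta *: iter t failed_round P).
  (* At t = 0 the expression is H - delta P. Each later one is the image under E of its predecessor,
     and E is linear and preserves positivity. *)
  elim: t => [|t IH].
    change (psd (P - failed_round P - delta *: P)).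
    by rewrite (failed_round_support m0) subKr.
  rewrite !iterS -failed_roundB -failed_roundZ -failed_roundB -iterS.
  exact: psd_failed_round.
rewrite (sub_scale_sum _ _ (fun t => iter t failed_round P)).
apply: psdD (psd_iter_failed_round _ _ pP).
by apply: psd_sum => t _; exact: step.
Qed.

Lemma halt_state_at_support a t :
  halt_state_at Pi a t
  = m%:R^-1 *: (d%:R^-1 *: (Pi a *m iter t failed_round P *m Pi a)).
Proof.
have mixedE : iter t failed_round (maximally_mixed R d)
    = d%:R^-1 *: iter t failed_round 1%:M.
  by elim: t => [//|t IH]; rewrite !iterS IH failed_roundZ.
rewrite halt_state_atE mixedE -scalemxAr -scalemxAl.
by rewrite projector_conj_iter_failed_round.
Qed.

Lemma halt_state_series_le a (delta : C) n : 0 < delta -> psd P ->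
  psd (hamiltonian Pi - delta *: P) ->
  psd ((m%:R * delta)^-1 *: (d%:R^-1 *: Pi a)
       - \sum_(0 <= t < n) halt_state_at Pi a t).
Proof.
move=> delta0 pP gapP.
have m0 : (0 < m)%N by case: (m) a => [[]|].
have mC : m%:R != 0 :> C by rewrite pnatr_eq0 -lt0n.
set S := \sum_(0 <= t < n) iter t failed_round P.
(* The factor delta is inserted and divided out, so that the telescoped bound of delta S by P
   applies under the conjugation. *)
have -> : \sum_(0 <= t < n) halt_state_at Pi a t
    = (m%:R * delta)^-1 *: (d%:R^-1 *: (Pi a *m (delta *: S) *m Pi a)).
  rewrite (eq_bigr _ (fun t _ => halt_state_at_support a t)) -!scaler_sumr.
  rewrite -mulmx_suml -mulmx_sumr -/S -scalemxAr -scalemxAl !scalerA.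
  congr (_ *: _); move: (d%:R^-1) => x; field.
  by rewrite mC gt_eqF.
(* Writing Pi_a in this form puts both terms of the difference under one conjugation. *)
have PPP : Pi a *m P *m Pi a = Pi a.
  by rewrite projector_mul_support; have [] := Pi_proj a.
rewrite -{1}PPP -!scalerBr -mulmxBl -mulmxBr.
apply: psdZ; first by rewrite invr_ge0 mulr_ge0 ?ler0n // ltW.
apply: psdZ; first by rewrite invr_ge0 ler0n.
exact: psd_projector_conj _ _ (Pi_proj a) (sum_iter_failed_round_le _ n m0 pP gapP).
Qed.

End Support.

Lemma psd_halt_state_at a t : psd (halt_state_at Pi a t).
Proof.
rewrite halt_state_atE; apply: psdZ; first by rewrite invr_ge0 ler0n.
apply: psd_projector_conj _ _ (Pi_proj a) _.
exact: psd_iter_failed_round _ _ psd_maximally_mixed.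
Qed.

End Process.

(** * Monotone convergence in the Loewner order *)

Section Limits.
Context {R : realType}.
Local Notation C := R[i].

Lemma cvg_real_complex (u : nat -> R) (l : R) : u @ \oo --> l ->
  (fun n => (u n)%:C : C^o) @ \oo --> (l%:C : C^o).
Proof.
move=> /cvgrPdist_lt ul; apply/cvgrPdist_lt => e e0.
(* A positive complex tolerance is real, so the real convergence hypothesis applies to it. *)
have eE : e = (complex.Re e)%:C by rewrite RRe_real // gtr0_real.
have : 0 < complex.Re e by move: e0; rewrite {1}eE ltcR.
move=> /ul; apply: filterS => n.
by rewrite eE -rmorphB /= normc_def /= expr0n addr0 sqrtr_sqr ltcR.
Qed.

(** Nonnegative complex numbers are real, which reduces the claim to monotone convergence of the
    real parts. *)
Lemma nondecreasing_cvg_complex (u : nat -> C) (B : C) :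
  (forall n, 0 <= u n) -> (forall n, u n <= u n.+1) -> (forall n, u n <= B) ->
  exists l : C, l <= B /\ (u : nat -> C^o) @ \oo --> (l : C^o).
Proof.
move=> u0 umono uB.
have uE n : u n = (complex.Re (u n))%:C by rewrite RRe_real // ger0_real.
have BE : B = (complex.Re B)%:C.
  by rewrite RRe_real // ger0_real // (le_trans (u0 0%N)).
have nd : nondecreasing_seq (fun n => complex.Re (u n)).
  by apply/nondecreasing_seqP => n; rewrite -lecR -!uE.
have ub n : complex.Re (u n) <= complex.Re B by rewrite -lecR -uE -BE.
have cu : cvgn (fun n => complex.Re (u n)).
  by apply: nondecreasing_is_cvgn => //; exists (complex.Re B) => _ [n _ <-].
exists (limn (fun n => complex.Re (u n)))%:C; split.
  by rewrite BE lecR; apply: limr_le => //; near=> n.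
by have := cvg_real_complex _ _ cu; under eq_cvg do rewrite -uE.
Unshelve. all: by end_near. Qed.

Context {d : nat}.

(** A matrix neighbourhood contains a product of neighbourhoods of its finitely many entries. *)
Lemma cvg_mx (u : nat -> 'M[C^o]_d) (L : 'M[C^o]_d) :
  (forall i j, (fun n => u n i j) @ \oo --> L i j) -> u @ \oo --> L.
Proof.
move=> uL A [P LP sPA].
have : \forall n \near \oo, forall i j, P i j (u n i j).
  by apply: filter_forall => i; apply: filter_forall => j; exact: uL (LP i j).
by apply: filterS => n; exact: sPA.
Qed.

Lemma cvg_mx_entry (u : nat -> 'M[C^o]_d) (L : 'M[C^o]_d) i j :
  u @ \oo --> L -> (fun n => u n i j) @ \oo --> L i j.
Proof.
move=> uL; exact: (@cvg_comp _ _ _ u (fun M : 'M[C^o]_d => M i j) _ _ _ uL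
  (@coord_continuous C d d i j L)).
Qed.

Lemma cvg_qform (u : nat -> 'M[C^o]_d) (L : 'M[C^o]_d) (v : 'cV[C]_d) :
  u @ \oo --> L ->
  (fun n => qform (u n) v : C^o) @ \oo --> (qform L v : C^o).
Proof.
move=> uL; rewrite qformE; under eq_cvg do rewrite qformE.
apply: cvg_big => // [|j _]; first exact: add_continuous.
apply: cvg_big => // [|i _]; first exact: add_continuous.
apply: cvgMl; apply: cvgMr; exact: cvg_mx_entry.
Qed.

Lemma cvg_mxtrace (u : nat -> 'M[C^o]_d) (L : 'M[C^o]_d) :
  u @ \oo --> L -> (fun n => \tr (u n) : C^o) @ \oo --> (\tr L : C^o).
Proof.
move=> uL; apply: cvg_big => // [|j _]; first exact: add_continuous.
exact: cvg_mx_entry.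
Qed.

(** Each quadratic form is a bounded nondecreasing scalar sequence, and each entry is a fixed linear
    combination of such forms. *)
Lemma psd_nondecreasing_cvg (u : nat -> 'M[C^o]_d) (B : 'M[C]_d) :
  (forall n, psd (u n)) -> (forall n, psd (u n.+1 - u n)) ->
  (forall n, psd (B - u n)) ->
  exists L : 'M[C]_d, psd (B - L) /\ u @ \oo --> (L : 'M[C^o]_d).
Proof.
move=> pu umono uB.
have /choice [q qP] v : exists l : C,
    l <= qform B v /\ (fun n => qform (u n) v : C^o) @ \oo --> (l : C^o).
  apply: nondecreasing_cvg_complex => n; first exact: pu.
    by rewrite -subr_ge0 -qformB; exact: umono.
  by rewrite -subr_ge0 -qformB; exact: uB.
pose e1 i : 'cV[C]_d := delta_mx i 0.
pose e2 z i j : 'cV[C]_d := delta_mx i 0 + z *: delta_mx j 0.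
(* The polarization identity applied to the limits [q] of the quadratic forms. *)
pose L : 'M[C]_d := \matrix_(i, j) (2^-1 *
  ((q (e2 1 i j) - q (e1 i) - q (e1 j))
   - 'i%R * (q (e2 'i%R i j) - q (e1 i) - q (e1 j)))).
have uL : u @ \oo --> (L : 'M[C^o]_d).
  apply: cvg_mx => i j; rewrite mxE; under eq_cvg do rewrite entry_qform.
  have qc v := (qP v).2.
  apply: cvgMr; apply: cvgB; first by do 2?apply: cvgB.
  by apply: cvgMr; do 2?apply: cvgB.
exists L; split=> // v; rewrite -/(qform _ v) qformB subr_ge0.
have -> : qform L v = q v; last by have [] := qP v.
exact: (cvg_unique (@norm_hausdorff _ _) (cvg_qform _ _ v uL) (qP v).2).
Qed.

End Limits.

(** * Passage to the limit for halting states and probabilities *)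

Theorem proposition38 (R : realType) (d m : nat) (Pi : 'I_m -> 'M[R[i]]_d)
    (delta lambda0 : R[i])
    (Pi_proj : forall i, projector (Pi i))
    (H_gap : spectral_gap (hamiltonian Pi) delta)
    (H_ground : smallest_eigenvalue (hamiltonian Pi) lambda0)
    (ground_gap : lambda0 = 0 \/ delta <= lambda0)
    (a : 'I_m) :
  let p_a := halt_prob Pi a in
  let rho_a := halt_state Pi a in
  let X_a := p_a *: rho_a in
  [/\ cvgn (series (halt_prob_at Pi a)) /\ cvgn (series (halt_state_at Pi a)),
      loewner_le X_a ((m%:R * delta)^-1 *: (d%:R^-1 *: Pi a)),
      p_a = \tr X_a
    & \tr X_a <= (m%:R * delta)^-1 * (\tr (Pi a) / d%:R)].
Proof.
have [l1 [l2 [[ev1 min1] [ev2 lt12] dich deltaE]]] := H_gap.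
have [ev0 min0] := H_ground.
have l1E : l1 = lambda0 by apply/le_anti; rewrite min1 ?min0.
have delta0 : 0 < delta by rewrite deltaE subr_gt0.
(* If the ground energy is 0, then delta is the second eigenvalue [l2]; otherwise every eigenvalue
   is at least [lambda0], hence at least delta. *)
have spec mu : eigenvalue (hamiltonian Pi) mu -> mu = 0 \/ delta <= mu.
  move=> ev; case: ground_gap => [l0|le_l0].
    by rewrite deltaE l1E l0 subr0 -{1}l0 -l1E; exact: dich.
  by right; exact: le_trans le_l0 (min0 _ ev).
have [P [pP Padj HP gapP]] :=
  support_projection _ _ (hermitian_hamiltonian _ Pi_proj) delta0 spec.
pose B := (m%:R * delta)^-1 *: (d%:R^-1 *: Pi a).
have pS n : psd (series (halt_state_at Pi a) n).
  by apply: psd_sum => t _; exact: psd_halt_state_at.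
have incS n : psd (series (halt_state_at Pi a) n.+1 - series (halt_state_at Pi a) n).
  have -> : series (halt_state_at Pi a) n.+1 - series (halt_state_at Pi a) n
          = halt_state_at Pi a n by rewrite seriesSB.
  exact: psd_halt_state_at.
have SB n : psd (B - series (halt_state_at Pi a) n).
  exact: (halt_state_series_le _ Pi_proj Padj HP a delta n delta0 pP gapP).
have [L [BL cL]] := psd_nondecreasing_cvg _ _ pS incS SB.
have trS : series (halt_prob_at Pi a) = fun n => \tr (series (halt_state_at Pi a) n).
  apply/funext => n; rewrite /series /= [RHS]raddf_sum.
  by apply: eq_bigr => t _; exact: halt_prob_atE.
have cp : series (halt_prob_at Pi a) @ \oo --> (\tr L : R[i]^o).
  by rewrite trS; exact: cvg_mxtrace.
move=> p_a rho_a X_a.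
have pE : p_a = \tr L := cvg_lim (@norm_hausdorff _ _) cp.
have limE : limn (series (halt_state_at Pi a)) = L :=
  cvg_lim (@norm_hausdorff _ _) cL.
have pB : psd B.
  apply: psdZ; first by rewrite invr_ge0 mulr_ge0 ?ler0n // ltW.
  by apply: psdZ; [rewrite invr_ge0 ler0n | exact: psd_projector].
have [trX BX] : p_a = \tr X_a /\ psd (B - X_a).
  rewrite /X_a /rho_a /halt_state -/p_a limE scalerA.
  (* For nonzero [p_a] the normalisation cancels and X_a is the limit [L]. For [p_a] zero, X_a is
     the zero matrix and the bound is positivity of [B]. *)
  have [->|p0] := eqVneq p_a 0; last first.
    by rewrite (mulfV p0) scale1r; split; [exact: pE | exact: BL].
  by rewrite mul0r scale0r linear0 subr0; split; last exact: pB.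
split; [| exact: BX | exact: trX |].
  by split; [exact: cvgP cp | exact: cvgP cL].
have leX : \tr X_a <= \tr B by rewrite -subr_ge0 -raddfB; exact: psd_tr BX.
apply: (le_trans leX).
by rewrite /B mxtraceZ mxtraceZ [d%:R^-1 * _]mulrC.
Qed.
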